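(* Let $K$ be a Hilbert space and $A,B\in B(K)$. Assume that $\ker A=0$ and that $\mathrm{Im}\,A^{*}+\mathrm{Im}\,B^{*}$ is closed in $K$. Let $(H,f)$ be the Hilbert representation of the Kronecker quiver $Q$ given by $H_1=H_2=K$, $f_\alpha=A$ and $f_\beta=B$. Then the operator $BA^{-1}$ is transitive if and only if $(H,f)$ is transitive.
   Context: All Hilbert spaces are complex. The Kronecker quiver $Q$ has two vertices $1,2$ and two arrows $\alpha,\beta$, both from $1$ to $2$. A Hilbert representation $(H,f)$ of $Q$ consists of Hilbert spaces $H_1,H_2$ and bounded operators $f_\alpha,f_\beta:H_1\to H_2$. $End(H,f)$ is the algebra of pairs $(S,T)\in B(H_1)\times B(H_2)$ with $f_\alpha S=Tf_\alpha$ and $f_\beta S=Tf_\beta$. $(H,f)$ is called transitive if $End(H,f)=\mathbb{C}(I_{H_1},I_{H_2})$. When $\ker A=0$, the quotient $BA^{-1}$ is the linear operator on $K$ with domain $\mathrm{Im}\,A$ given by $Ax\mapsto Bx$, $x\in K$. An ''unbounded closed operator'' $C$ on $K$ means a closed linear operator with domain a linear subspace $D(C)\subset K$ (not necessarily bounded, not necessarily densely defined). Its (bounded) commutant is $\{C\}'=\{S\in B(K): S(D(C))\subset D(C)\text{ and }CSx=SCx\text{ for all }x\in D(C)\}$. The closed operator $C$ is called transitive if every $T\in\{C\}'$ is a scalar operator. *)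

(* Defs.v *)
From HB Require Import structures.
From mathcomp Require Import all_boot all_order all_algebra.
From mathcomp Require Import complex.
From mathcomp Require Import all_classical all_reals topology normedtype.

Set Implicit Arguments.
Unset Strict Implicit.
Unset Printing Implicit Defensive.

Import Order.TTheory GRing.Theory Num.Theory.
Import numFieldNormedType.Exports.

Local Open Scope classical_set_scope.
Local Open Scope ring_scope.
Local Open Scope complex_scope.

(* The inner product is linear in its first argument and conjugate linear in
   its second one; the norm takes its values in R[i]. *)
HB.mixin Record NormedModule_isHilbert (R : realType) H
    of CompleteNormedModule R[i] H := {
  inner : {dot H for Num.conj};
  norm_inner : forall x : H, `|x| ^+ 2 = inner x x }.

#[short(type="hilbertType")]
HB.structure Definition Hilbert (R : realType) :=
  { H of NormedModule_isHilbert R H & CompleteNormedModule R[i] H }.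

Record bounded_operator (R : realType) (H1 H2 : hilbertType R) := BoundedOperator {
  bop_fun :> {linear H1 -> H2};
  bop_bounded : exists M : R[i], forall x, `|bop_fun x| <= M * `|x| }.

Notation "''B(' H1 , H2 )" := (bounded_operator H1 H2)
  (at level 0, H1 at level 99, H2 at level 99, format "''B(' H1 ,  H2 )").

(* [xget 0 P] picks an element of [P]; here [P] is a singleton by the Riesz
   representation theorem. *)
Definition adjoint (R : realType) (H1 H2 : hilbertType R) (A : 'B(H1, H2))
    (y : H2) : H1 :=
  xget 0 [set z | forall x, inner (A x) y = inner x z].

Definition ker (R : realType) (H1 H2 : hilbertType R) (A : 'B(H1, H2)) : set H1 :=
  [set x | A x = 0].

(* Only the restriction of [op_fun] to [op_dom] is meaningful. *)
Record unbounded_operator (R : realType) (K : hilbertType R) := UnboundedOperator {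
  op_dom : set K;
  op_fun :> K -> K;
  op_dom0 : op_dom 0;
  op_domP : forall a x y, op_dom x -> op_dom y -> op_dom (a *: x + y);
  op_linear : forall a x y, op_dom x -> op_dom y ->
    op_fun (a *: x + y) = a *: op_fun x + op_fun y }.

Definition closed_operator (R : realType) (K : hilbertType R)
    (C : unbounded_operator K) : Prop :=
  closed [set p : K * K | op_dom C p.1 /\ p.2 = C p.1].

Definition commutant (R : realType) (K : hilbertType R)
    (C : unbounded_operator K) : set 'B(K, K) :=
  [set S : 'B(K, K) | (forall x, op_dom C x -> op_dom C (S x)) /\
                     (forall x, op_dom C x -> C (S x) = S (C x))].

Definition scalar_operator (R : realType) (K : hilbertType R)
    (S : 'B(K, K)) : Prop :=
  exists c : R[i], forall x, S x = c *: x.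

Definition transitive_operator (R : realType) (K : hilbertType R)
    (C : unbounded_operator K) : Prop :=
  closed_operator C /\ forall T, commutant C T -> scalar_operator T.

Section Quotient.
Context (R : realType) (K : hilbertType R) (B A : 'B(K, K)).
Hypothesis kerA : ker A = [set 0].

Definition quotient_dom : set K := range A.

Definition quotient_fun (y : K) : K := B (xget 0 [set x | A x = y]).

Lemma quotient_funE x : quotient_fun (A x) = B x.
Proof.
rewrite /quotient_fun; congr (B _).
have : A (xget 0 [set z | A z = A x]) = A x.
  exact: (@xgetPex _ 0 [set z | A z = A x]) (ex_intro _ x erefl).
set z := xget _ _ => Az; apply/eqP; rewrite -subr_eq0; apply/eqP.
have : ker A (z - x) by rewrite /ker /= linearB Az subrr.
by rewrite kerA.
Qed.

Lemma quotient_dom0 : quotient_dom 0.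
Proof. by exists 0; rewrite ?linear0. Qed.

Lemma quotient_domP a x y :
  quotient_dom x -> quotient_dom y -> quotient_dom (a *: x + y).
Proof. by move=> [u _ <-] [v _ <-]; exists (a *: u + v); rewrite ?linearP. Qed.

Lemma quotient_linear a x y : quotient_dom x -> quotient_dom y ->
  quotient_fun (a *: x + y) = a *: quotient_fun x + quotient_fun y.
Proof.
by move=> [u _ <-] [v _ <-]; rewrite -linearP !quotient_funE linearP.
Qed.

Definition quotient : unbounded_operator K :=
  UnboundedOperator quotient_dom0 quotient_domP quotient_linear.

End Quotient.

Record kronecker_rep (R : realType) := KroneckerRep {
  rep1 : hilbertType R;
  rep2 : hilbertType R;
  rep_alpha : 'B(rep1, rep2);
  rep_beta : 'B(rep1, rep2) }.

Definition rep_End (R : realType) (r : kronecker_rep R) :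
    set ('B(rep1 r, rep1 r) * 'B(rep2 r, rep2 r)) :=
  [set p : 'B(rep1 r, rep1 r) * 'B(rep2 r, rep2 r) |
     (forall x, rep_alpha r (p.1 x) = p.2 (rep_alpha r x)) /\
     (forall x, rep_beta r (p.1 x) = p.2 (rep_beta r x))].

Arguments rep_End {R} r.

Definition transitive_rep (R : realType) (r : kronecker_rep R) : Prop :=
  rep_End r = [set p : 'B(rep1 r, rep1 r) * 'B(rep2 r, rep2 r) |
    exists c : R[i], (forall x, p.1 x = c *: x) /\ (forall y, p.2 y = c *: y)].

(* Main.v *)
Require Import Defs.
From HB Require Import structures.
From mathcomp Require Import all_boot all_order all_algebra.
From mathcomp Require Import complex ring lra.
From mathcomp Require Import all_classical all_reals topology normedtype.

(** Write [C] for the quotient of [B] by [A].  Its graph is the range of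
    [x |-> (A x, B x)].  If the representation is transitive, two things have to
    be shown for [C], and both follow from one inequality: there is [M] with
    [|x| <= M (|A x| + |B x|)] for all [x] ([bounded_below]).

    - Transitivity of [C] includes that [C] is closed.  The inequality turns a
      convergent sequence [(A x_n, B x_n)] into a Cauchy sequence [x_n], so the
      graph is closed ([closed_joint_range]).
    - An operator [S] commuting with [C] maps the range of [A] to itself, so
      [S1 := A^-1 S A] is a linear map with [A S1 = S A] and [B S1 = S B].  For
      [(S1, S)] to be an endomorphism of the representation [S1] has to be
      bounded, and the inequality bounds [S1 x] by [S A x] and [S B x]
      ([commutant_lift]).

    Conversely, if [(S1, S)] is an endomorphism then [S] commutes with [C]; and
    if moreover [S] is the scalar [c], so is [S1], because [A] is injective.

    The inequality is the closed range theorem for the pair [(A, B)].  A vector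
    orthogonal to [Im A^* + Im B^*] is killed by [A], hence is zero; as this
    subspace is closed, it is the whole space ([adjoint_sum_surjective]).  Every
    [w] is then some [A^* y + B^* z], and on the set of the [x] with
    [|A x| + |B x| <= 1] the functional [<x, w> = <A x, y> + <B x, z>] is
    bounded by [|y| + |z|].  This set is thus weakly bounded, hence bounded by
    the uniform boundedness principle ([weakly_bounded_bounded]).

    The adjoints have their meaning through the Riesz representation theorem
    ([riesz]), which like the density argument above rests on projection onto
    closed subspaces ([orthogonal_projection]). *)

Set Implicit Arguments.
Unset Strict Implicit.
Unset Printing Implicit Defensive.

Import Order.TTheory GRing.Theory Num.Theory.
Import numFieldNormedType.Exports.

Local Open Scope classical_set_scope.
Local Open Scope ring_scope.
Local Open Scope complex_scope.

Local Notation Re := complex.Re.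

(** * The norm as a real number *)

Section RealNorm.
Context (R : realType).

Lemma inv_succ_lt (e : R) : 0 < e -> exists n : nat, n.+1%:R^-1 < e.
Proof.
move=> e0; exists (Num.truncn e^-1).
by rewrite invf_plt ?posrE ?ltr0Sn // truncnS_gt.
Qed.

Lemma le_add_inv_succ (a b C : R) :
  (forall n : nat, a <= b + C / n.+1%:R) -> a <= b.
Proof.
move=> ab; rewrite leNgt; apply/negP => ba.
have C0 : 0 < C by move: (ab 0%N); rewrite divr1; lra.
have [|n] := @inv_succ_lt ((a - b) / C); first by rewrite divr_gt0 // subr_gt0.
by rewrite ltr_pdivlMr // mulrC => h; have := ab n; rewrite -lerBlDl leNgt h.
Qed.

Lemma gt0_complexE (e : R[i]) : 0 < e -> exists2 r : R, 0 < r & e = r%:C.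
Proof.
move=> e0; have eE : e = (Re e)%:C by rewrite RRe_real // gtr0_real.
by exists (Re e); rewrite // -ltcR -eE.
Qed.

(** Norms take values in the partially ordered field [R[i]]; their real parts
    carry the same information and live in an ordered field, where infima and
    linear arithmetic make sense. *)
Definition renorm (V : normedModType R[i]) (x : V) : R := Re `|x|.

Section Normed.
Context (V : normedModType R[i]).
Implicit Types x y : V.

Lemma renormE x : `|x| = (renorm x)%:C.
Proof. by rewrite /renorm RRe_real // normr_real. Qed.

Lemma renorm_ge0 x : 0 <= renorm x.
Proof. by rewrite -ler0c -renormE. Qed.

Lemma renorm0 : renorm (0 : V) = 0.
Proof. by rewrite /renorm normr0. Qed.

Lemma renorm_eq0 x : (renorm x == 0) = (x == 0).
Proof. by rewrite -[LHS](inj_eq (@complexI R)) -renormE normr_eq0. Qed.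

Lemma renormN x : renorm (- x) = renorm x.
Proof. by rewrite /renorm normrN. Qed.

Lemma renormB x y : renorm (x - y) = renorm (y - x).
Proof. by rewrite -renormN opprB. Qed.

Lemma renormD x y : renorm (x + y) <= renorm x + renorm y.
Proof. by rewrite -lecR rmorphD /= -!renormE ler_normD. Qed.

Lemma renorm_closure (M : set V) x : closed M ->
  (forall e : R, 0 < e -> exists2 m, M m & renorm (x - m) < e) -> M x.
Proof.
move=> Mcl xM; apply: Mcl => U /nbhs_ballP [e /= e0 eU].
have [r r0 eE] := gt0_complexE e0.
have [m Mm xm] := xM _ r0.
exists m; split=> //; apply: eU.
by rewrite -ball_normE /ball_ /= renormE eE ltcR.
Qed.
End Normed.

Lemma renormZ (V : normedModType R[i]) (a : R[i]) (x : V) :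
  renorm (a *: x) = renorm (a : R[i]^o) * renorm x.
Proof. by apply: (@complexI R); rewrite rmorphM /= -!renormE normrZ. Qed.

Lemma renorm_real (a : R) : 0 <= a -> renorm (a%:C : R[i]^o) = a.
Proof. by move=> a0; apply: (@complexI R); rewrite -renormE ger0_norm ?ler0c. Qed.

(** Every limit below is obtained from an explicit modulus [e], which then also
    controls the distance to the limit. *)
Lemma renorm_cauchy (V : completeNormedModType R[i]) (u : nat -> V)
    (e : nat -> R) :
  (forall n m, (n <= m)%N -> renorm (u m - u n) <= e n) ->
  (forall d, 0 < d -> exists n, e n < d) ->
  exists l, forall n, renorm (l - u n) <= e n.
Proof.
move=> ue e0.
have /cauchy_cvg ucvg : cauchy (u @ \oo).
  apply: cauchy_exP => d d0.
  have [r r0 dE] := gt0_complexE d0.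
  have [n nd] := e0 _ r0; exists (u n).
  exists n => // m /= nm.
  rewrite -ball_normE /ball_ /= renormE dE ltcR renormB.
  exact: le_lt_trans (ue _ _ nm) nd.
exists (lim (u @ \oo)) => n; apply/ler_addgt0Pr => d d0.
have /cvgrPdist_lt /(_ d%:C) : u @ \oo --> lim (u @ \oo) by [].
rewrite ltcR => /(_ d0) [N _ Nd].
have := Nd (maxn N n) (leq_maxl _ _); rewrite renormE ltcR => ld.
have := ue n (maxn N n) (leq_maxr _ _) => un.
have := renormD (lim (u @ \oo) - u (maxn N n)) (u (maxn N n) - u n).
rewrite addrA subrK; lra.
Qed.
End RealNorm.

Section HilbertGeometry.
Context (R : realType) (H : hilbertType R).
Implicit Types x y w : H.

Lemma renorm_inner x : ((renorm x) ^+ 2)%:C = inner x x.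
Proof. by rewrite rmorphXn /= -renormE norm_inner. Qed.

Lemma innerC x y : inner x y = (inner y x)^*%C.
Proof. by rewrite hermC expr0 mul1r. Qed.

Lemma inner_eq0_sym x y : inner x y = 0 -> inner y x = 0.
Proof. by move=> xy0; rewrite innerC xy0 conjc0. Qed.

Lemma parallelogram x y :
  renorm (x + y) ^+ 2 + renorm (x - y) ^+ 2 =
  2 * (renorm x ^+ 2 + renorm y ^+ 2).
Proof.
apply: (@complexI R).
rewrite rmorphM rmorph_nat !rmorphD /= !renorm_inner dnormD dnormB; ring.
Qed.

(** Pythagoras for the decomposition of [x] along [y]; positivity of the left
    hand side gives Cauchy-Schwarz, its minimality gives orthogonality. *)
Lemma inner_residual x y : y != 0 ->
  inner (x - (inner x y / inner y y) *: y) (x - (inner x y / inner y y) *: y)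
  = inner x x - `|inner x y| ^+ 2 / inner y y.
Proof.
move=> y0.
have yy0 : inner y y != 0 by rewrite dnorm_eq0.
have yyJ : Num.conj (inner y y) = inner y y by rewrite geC0_conj // dnorm_ge0.
have tJ : Num.conj (inner x y / inner y y) = Num.conj (inner x y) / inner y y.
  by rewrite rmorphM /= fmorphV /= yyJ.
move: tJ; set t := inner x y / _; have : t = inner x y / inner y y by [].
move: t => t tE tJ.
rewrite dnormB dnormZ linearZr_LR /= !normCK rmorphM /= conjCK tJ tE.
by field.
Qed.

Lemma cauchy_schwarz x y :
  renorm (inner x y : R[i]^o) <= renorm x * renorm y.
Proof.
have [->|y0] := eqVneq y 0.
  by rewrite linear0r !renorm0 mulr0.
have := dnorm_ge0 (inner (s := H)) (x - (inner x y / inner y y) *: y).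
rewrite inner_residual // subr_ge0 ler_pdivrMr ?dnorm_gt0 //.
rewrite (renormE (inner x y : R[i]^o)) -!renorm_inner -rmorphXn -rmorphM /= lecR.
by rewrite -exprMn ler_pXn2r // nnegrE ?mulr_ge0 // renorm_ge0.
Qed.

(** A best approximation is an orthogonal projection: correcting [w] by its
    component along [y] would otherwise shorten it. *)
Lemma minimal_orthogonal w y :
  (forall t : R[i], renorm w <= renorm (w - t *: y)) -> inner w y = 0.
Proof.
move=> wmin; have [->|y0] := eqVneq y 0; first by rewrite linear0r.
have := wmin (inner w y / inner y y).
rewrite -ler_sqr ?nnegrE ?renorm_ge0 // -lecR !renorm_inner inner_residual //.
rewrite -subr_ge0 addrAC subrr add0r oppr_ge0 pmulr_lle0 ?invr_gt0 ?dnorm_gt0 //.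
move=> n0.
have : `|inner w y| ^+ 2 == 0 by rewrite eq_le n0 exprn_ge0.
by rewrite sqrf_eq0 normr_eq0 => /eqP.
Qed.

End HilbertGeometry.

(** * Orthogonal projections *)

Lemma sumB_midpoint (F : numFieldType) (V : lmodType F) (x u v : V) :
  x - u + (x - v) = 2 *: (x - (2^-1 *: u + 2^-1 *: v)).
Proof.
rewrite scalerBr scalerDr !scalerA mulfV ?pnatr_eq0 // !scale1r.
by rewrite scaler_nat mulr2n opprD addrACA.
Qed.

Section Projection.
Context (R : realType) (H : hilbertType R).

Definition linear_subspace (M : set H) :=
  M 0 /\ forall (a : R[i]) x y, M x -> M y -> M (a *: x + y).

(** By the parallelogram law, two points of [M] that nearly realise the distance
    to [x] are close to each other, because their midpoint is in [M] and cannot be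
    closer to [x]; so a minimising sequence converges, to the projection. *)
Lemma orthogonal_projection (M : set H) (x : H) :
  closed M -> linear_subspace M ->
  exists2 m, M m & forall u, M u -> inner (x - m) u = 0.
Proof.
move=> Mcl [M0 MP].
pose S := [set renorm (x - m) ^+ 2 | m in M].
have S0 : has_inf S.
  split; first by exists (renorm (x - 0) ^+ 2), 0.
  by exists 0 => _ [m _ <-]; rewrite exprn_ge0 // renorm_ge0.
pose d := inf S.
have dle m : M m -> d <= renorm (x - m) ^+ 2.
  by move=> Mm; apply: (ge_inf (proj2 S0)); exists m.
have d0 : 0 <= d.
  apply: lb_le_inf (proj1 S0) _ => _ [m _ <-].
  by rewrite exprn_ge0 // renorm_ge0.
pose q (n : nat) : R := n.+1%:R^-1.
have q0 n : 0 < q n by rewrite invr_gt0 ltr0Sn.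
have q1 n : q n <= 1 by rewrite invf_le1 ?ltr0Sn // ler1n.
(* The square of [q n] makes the modulus of the minimising sequence linear in
   [q n]. *)
have /choice[u uP] n : exists m, M m /\ renorm (x - m) ^+ 2 < d + q n ^+ 2.
  have [_ [m Mm <-] md] := inf_adherent (exprn_gt0 2 (q0 n)) S0.
  by exists m.
have ucauchy n m : (n <= m)%N -> renorm (u m - u n) <= 2 * q n.
  move=> nm; have [Mn un] := uP n; have [Mm um] := uP m.
  have qnm : q m <= q n by rewrite lef_pV2 ?posrE ?ltr0Sn // ler_nat.
  have qnm2 : q m ^+ 2 <= q n ^+ 2 by rewrite ler_sqr // nnegrE ltW.
  pose mid := 2^-1 *: u n + 2^-1 *: u m.
  have Mmid : M mid by apply: (MP) => //; rewrite -[_ *: u m]addr0; apply: MP.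
  have := dle _ Mmid.
  have := parallelogram (x - u n) (x - u m).
  have -> : x - u n + (x - u m) = 2 *: (x - mid).
    exact: sumB_midpoint.
  have -> : x - u n - (x - u m) = u m - u n.
    by rewrite opprB addrC addrA subrK.
  rewrite renormZ.
  have -> : renorm (2 : R[i]^o) = 2.
    by rewrite -[2]/(2%:R) -(rmorph_nat (real_complex R)) renorm_real.
  move=> par dmid.
  rewrite -ler_sqr ?nnegrE ?renorm_ge0 ?mulr_ge0 ?ltW //.
  move: par dmid; rewrite !exprMn; lra.
have [e e0|l lu] := renorm_cauchy ucauchy.
  have [n nE] := inv_succ_lt (divr_gt0 e0 (ltr0Sn R 1)).
  by exists n; rewrite mulrC -ltr_pdivlMr // ltr0Sn.
have Ml : M l.
  apply: (renorm_closure Mcl) => e e0.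
  have [n nE] := inv_succ_lt (divr_gt0 e0 (ltr0Sn R 1)).
  exists (u n); first exact: (uP n).1.
  by apply: le_lt_trans (lu n) _; rewrite mulrC -ltr_pdivlMr // ltr0Sn.
(* From [|x - l| <= |x - u n| + 2 q n], [|x - u n| <= d + 1] and [q n <= 1], the
   excess of [|x - l|^2] over [d] is at most [(4 (d + 2) + 5) q n]. *)
have xl : renorm (x - l) ^+ 2 <= d.
  apply: (@le_add_inv_succ _ _ _ (4 * (d + 2) + 5)) => n.
  rewrite -/(q n).
  have tri : renorm (x - l) <= renorm (x - u n) + 2 * q n.
    have := renormD (x - u n) (u n - l); rewrite addrA subrK.
    by have := lu n; rewrite renormB; lra.
  have := (uP n).2; have := renorm_ge0 (x - l); have := renorm_ge0 (x - u n).
  move: (q0 n) (q1 n) tri d0.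
  move: (renorm (x - l)) (renorm (x - u n)) (q n) (d).
  move=> a b c D c0 c1 ab D0 b0 a0 bD.
  have bD1 : b <= D + 1 by nra.
  have : a ^+ 2 <= (b + 2 * c) ^+ 2 by rewrite ler_sqr ?nnegrE; lra.
  nra.
exists l => // v Mv; apply: minimal_orthogonal => t.
rewrite -ler_sqr ?nnegrE ?renorm_ge0 //; apply: le_trans xl _.
have -> : x - l - t *: v = x - (t *: v + l) by rewrite opprD addrA addrAC.
exact/dle/MP.
Qed.

End Projection.

(** * The Riesz representation theorem and adjoints *)

(** The kernel of a nonzero functional is a closed hyperplane, and the functional
    is a multiple of the inner product with a vector normal to it. *)
Lemma riesz (R : realType) (H : hilbertType R) (phi : H -> R[i]) (C : R) :
  (forall (a : R[i]) x y, phi (a *: x + y) = a * phi x + phi y) ->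
  (forall x, renorm (phi x : R[i]^o) <= C * renorm x) ->
  exists z, forall x, phi x = inner x z.
Proof.
move=> phiP phiC.
have phi0 : phi 0 = 0.
  have := phiP 1 0 0; rewrite scaler0 addr0 mul1r => /eqP.
  by rewrite -subr_eq0 opprD addrA subrr sub0r oppr_eq0 => /eqP.
have phiB x y : phi (x - y) = phi x - phi y.
  have -> : x - y = -1 *: y + x by rewrite scaleN1r addrC.
  by rewrite phiP mulN1r addrC.
have [phi_eq0|/existsNP[x0 /eqP x00]] := pselect (forall x, phi x = 0).
  by exists 0 => x; rewrite phi_eq0 linear0r.
pose M := [set x | phi x = 0].
have Mcl : closed M.
  move=> x clx; apply/eqP; rewrite -(@renorm_eq0 R R[i]^o) eq_le renorm_ge0 andbT.
  apply/ler_addgt0Pr => e e0; rewrite add0r.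
  have C1 : 0 < `|C| + 1 by rewrite ltr_wpDl.
  have ec : 0 < (e / (`|C| + 1))%:C by rewrite ltcR divr_gt0.
  have [y [My]] := clx _ (nbhsx_ballx x _ ec).
  rewrite -ball_normE /ball_ /= renormE ltcR ltr_pdivlMr // => xy.
  have := phiC (x - y); rewrite phiB My subr0 => /le_trans; apply.
  apply: le_trans (ltW xy); rewrite mulrC ler_wpM2l ?renorm_ge0 //.
  by rewrite ler_wpDr // ler_norm.
have Msub : linear_subspace M.
  by split=> [|a x y Mx My]; [exact: phi0 | rewrite /M /= phiP Mx My mulr0 addr0].
have [m Mm orth] := orthogonal_projection x0 Mcl Msub.
set w := x0 - m in orth.
have phiw : phi w != 0 by rewrite phiB Mm subr0.
have w0 : w != 0 by apply: contra_neq phiw => ->.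
have ww0 : inner w w != 0 by rewrite dnorm_eq0.
exists (Num.conj (phi w / inner w w) *: w) => x.
rewrite linearZr_LR /= conjCK.
have Mx : M (x - (phi x / phi w) *: w).
  have -> : x - (phi x / phi w) *: w = (- (phi x / phi w)) *: w + x.
    by rewrite scaleNr addrC.
  by rewrite /M /= phiP mulNr divfK // addNr.
have := inner_eq0_sym (orth _ Mx).
rewrite linearBl linearZl_LR /= => /eqP; rewrite subr_eq0 => /eqP ->.
by field; rewrite phiw.
Qed.

Section Operators.
Context (R : realType) (H1 H2 : hilbertType R).
Implicit Types A B : 'B(H1, H2).

Lemma bounded_renorm A : exists2 C : R, 0 <= C &
  forall x, renorm (A x) <= C * renorm x.
Proof.
have [M AM] := bop_bounded A.
exists (renorm (M : R[i]^o)) => [|x]; first exact: renorm_ge0.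
rewrite -lecR rmorphM /= -(renormE (M : R[i]^o)) -(renormE x) -(renormE (A x)).
have Mx0 : 0 <= M * `|x| := le_trans (normr_ge0 _) (AM x).
by rewrite -[X in _ * X]normr_id -normrM ger0_norm.
Qed.

(** The adjoint, defined by choice, is meaningful since Riesz provides a value. *)
Lemma adjointP A x y : inner (A x) y = inner x (adjoint A y).
Proof.
have [C C0 AC] := bounded_renorm A.
have [|u|z Az] := @riesz _ _ (fun x => inner (A x) y) (C * renorm y).
- by move=> a u v; rewrite linearP linearDl linearZl_LR.
- apply: le_trans (cauchy_schwarz _ _) _.
  by rewrite mulrAC ler_wpM2r ?renorm_ge0.
exact: (@xgetPex _ 0 [set z | forall x, inner (A x) y = inner x z])
  (ex_intro _ z Az) x.
Qed.

Lemma inner_inj (u v : H1) : (forall x, inner x u = inner x v) -> u = v.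
Proof.
move=> uv; apply/eqP; rewrite -subr_eq0 -(dnorm_eq0 (inner (s := H1))).
by rewrite linearBr /= uv subrr.
Qed.

Lemma adjoint_linear A (a : R[i]) x y :
  adjoint A (a *: x + y) = a *: adjoint A x + adjoint A y.
Proof.
apply: inner_inj => z.
by rewrite -adjointP !linearDr !linearZr_LR /= -!adjointP.
Qed.

Lemma adjoint_sum_subspace A B :
  linear_subspace [set x + y | x in range (adjoint A) & y in range (adjoint B)].
Proof.
have adj0 A' : adjoint A' 0 = 0.
  by apply: inner_inj => z; rewrite -adjointP !linear0r.
split.
  exists 0; first by exists 0; rewrite ?adj0.
  by exists 0; [exists 0; rewrite ?adj0 | rewrite addr0].
move=> a _ _ [_ [u1 _ <-] [_ [v1 _ <-] <-]] [_ [u2 _ <-] [_ [v2 _ <-] <-]].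
exists (adjoint A (a *: u1 + u2)); first by exists (a *: u1 + u2).
exists (adjoint B (a *: v1 + v2)); first by exists (a *: v1 + v2).
by rewrite !adjoint_linear scalerDr addrACA.
Qed.

(** The orthogonal complement of the closed subspace is zero: if [v] is orthogonal
    to [A^* A v + B^* B v] then [|A v|^2 + |B v|^2 = 0]. *)
Lemma adjoint_sum_surjective A B :
  (forall x, A x = 0 -> B x = 0 -> x = 0) ->
  closed [set x + y | x in range (adjoint A) & y in range (adjoint B)] ->
  forall w, exists y z, w = adjoint A y + adjoint B z.
Proof.
move=> kerAB cl w.
have [m Mm orth] := orthogonal_projection w cl (adjoint_sum_subspace A B).
have : inner (w - m) (adjoint A (A (w - m)) + adjoint B (B (w - m))) = 0.
  by apply: orth; exists (adjoint A (A (w - m))); [exists (A (w - m)) |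
    exists (adjoint B (B (w - m))) => //; exists (B (w - m))].
rewrite linearDr /= -!adjointP => /eqP.
rewrite paddr_eq0 ?dnorm_ge0 // !dnorm_eq0 => /andP[/eqP Av /eqP Bv].
have /eqP := kerAB _ Av Bv; rewrite subr_eq0 => /eqP ->.
by have [_ [y _ <-] [_ [z _ <-] <-]] := Mm; exists y, z.
Qed.
End Operators.

(** * Uniform boundedness *)

Section UniformBoundedness.
Context (R : realType) (H : hilbertType R).

(** One of [w + v] and [w - v], for [v] the multiple of [s] of norm [r], has a
    large inner product with [s], since the two inner products differ by
    [2 <s, v>], of modulus [2 r |s|]. *)
Lemma gliding_step (s w : H) (r : R) : 0 <= r ->
  exists2 w' : H, renorm (w' - w) <= r &
    r * renorm s <= renorm (inner s w' : R[i]^o).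
Proof.
move=> r0.
have [->|s0] := eqVneq s 0.
  by exists w; rewrite ?subrr renorm0 ?mulr0 ?renorm_ge0.
have s0' : renorm s != 0 by rewrite renorm_eq0.
pose v := (r / renorm s)%:C *: s.
have rs0 : 0 <= r / renorm s by rewrite divr_ge0 ?renorm_ge0.
have vr : renorm v = r by rewrite renormZ renorm_real // divfK.
have sv : renorm (inner s v : R[i]^o) = r * renorm s.
  have -> : inner s v = (r * renorm s)%:C.
    rewrite linearZr_LR /= geC0_conj ?ler0c // -renorm_inner -rmorphM /=.
    by congr (_%:C); field.
  by rewrite renorm_real // mulr_ge0 ?renorm_ge0.
have [big|small] := lerP (r * renorm s) (renorm (inner s (w + v) : R[i]^o)).
  by exists (w + v); rewrite // addrC addKr vr.
exists (w - v); first by rewrite addrC addKr renormN vr.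
have := renormD (inner s (w + v) : R[i]^o) (- inner s (w - v)).
rewrite renormN.
have -> : inner s (w + v) - inner s (w - v) = 2 * inner s v.
  by rewrite linearDr linearBr; ring.
have -> : renorm (2 * inner s v : R[i]^o) = 2 * (r * renorm s).
  apply: (@complexI R); rewrite -renormE normrM rmorphM rmorph_nat /= -sv.
  by rewrite -(renormE (inner s v : R[i]^o)) normr_nat.
lra.
Qed.

(** Gliding hump: if [S] is unbounded, take [s n] in [S] of norm more than
    [n 3^n] and move [w] at step [n] by at most [3^-n] so that [<s n, w>] has
    modulus at least [3^-n |s n|].  All later moves add up to at most half of
    [3^-n], so at the limit this modulus is still at least [n / 2], for each [n]. *)
Lemma weakly_bounded_bounded (S : set H) :
  (forall w, exists c : R, forall s, S s -> renorm (inner s w : R[i]^o) <= c) ->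
  exists M : R, forall s, S s -> renorm s <= M.
Proof.
move=> Sw; apply: contrapT => unbounded.
have /choice[s sP] n : exists s, S s /\ n%:R * 3 ^+ n < renorm s.
  apply: contrapT => nos; apply: unbounded; exists (n%:R * 3 ^+ n) => t St.
  by rewrite leNgt; apply/negP => tn; apply: nos; exists t.
pose r (n : nat) : R := 3 ^- n.
have r0 n : 0 < r n by rewrite invr_gt0 exprn_gt0.
have rS n : r n.+1 = r n / 3 by rewrite /r exprS invfM mulrC.
have /choice[step stepP] (nw : nat * H) : exists w',
    renorm (w' - nw.2) <= r nw.1 /\
    r nw.1 * renorm (s nw.1) <= renorm (inner (s nw.1) w' : R[i]^o).
  have [w' ? ?] := gliding_step (s nw.1) nw.2 (ltW (r0 nw.1)).
  by exists w'.
pose w := nat_rect (fun _ => H) 0 (fun n v => step (n, v)).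
have wS n : renorm (w n.+1 - w n) <= r n := (stepP (n, w n)).1.
have sw n : r n * renorm (s n) <= renorm (inner (s n) (w n.+1) : R[i]^o) :=
  (stepP (n, w n)).2.
have wcauchy n m : (n <= m)%N -> renorm (w m - w n) <= 3 / 2 * r n.
  move=> /subnKC <-; set k := (m - n)%N.
  suff : renorm (w (n + k)%N - w n) <= 3 / 2 * (r n - r (n + k)%N).
    by have := r0 (n + k)%N; lra.
  elim: k => [|k IHk]; first by rewrite addn0 !subrr mulr0 renorm0.
  rewrite addnS rS.
  have := renormD (w (n + k).+1 - w (n + k)%N) (w (n + k)%N - w n).
  by rewrite addrA subrK; have := wS (n + k)%N; lra.
have [d d0|l lw] := renorm_cauchy wcauchy.
  have [n nd] := inv_succ_lt d0; exists n.+2.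
  apply: le_lt_trans nd.
  have : r n <= n.+1%:R^-1.
    rewrite lef_pV2 ?posrE ?ltr0Sn ?exprn_gt0 //.
    by rewrite -natrX ler_nat ltn_expl.
  by apply: le_trans; rewrite !rS; have := r0 n; lra.
have [c lc] := Sw l.
(* [w n.+1] is the point reached by the step that looks at [s n]; the limit is
   within [3 / 2 * 3^-(n+1) = 3^-n / 2] of it. *)
have cn n : n%:R <= 2 * c.
  have [Sn sn] := sP n.
  have h1 : renorm (inner (s n) (w n.+1 - l) : R[i]^o) <=
            renorm (s n) * (r n / 2).
    apply: le_trans (cauchy_schwarz _ _) _.
    rewrite ler_wpM2l ?renorm_ge0 // renormB.
    by have := lw n.+1; rewrite rS; lra.
  have := renormD (inner (s n) (w n.+1 - l) : R[i]^o) (inner (s n) l).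
  rewrite -linearDr subrK.
  have h2 : n%:R <= r n * renorm (s n).
    by rewrite mulrC ler_pdivlMr ?exprn_gt0 // ltW.
  have := sw n; have := lc _ Sn; nra.
have := cn (Num.truncn (2 * c)).+1.
by rewrite leNgt truncnS_gt.
Qed.
End UniformBoundedness.

(** * The closed range theorem for a pair of operators *)

Section JointlyBoundedBelow.
Context (R : realType) (H1 H2 : hilbertType R) (A B : 'B(H1, H2)).
Hypothesis kerAB : forall x, A x = 0 -> B x = 0 -> x = 0.
Hypothesis closed_sum :
  closed [set x + y | x in range (adjoint A) & y in range (adjoint B)].

(** The set [S] where the right hand side is at most [1] is weakly bounded because
    each [w] is a sum of values of the adjoints; homogeneity does the rest. *)
Lemma bounded_below : exists2 M : R, 0 <= M &
  forall x, renorm x <= M * (renorm (A x) + renorm (B x)).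
Proof.
pose S := [set x | renorm (A x) + renorm (B x) <= 1].
have [w|M SM] := @weakly_bounded_bounded _ H1 S.
  have [y [z ->]] := adjoint_sum_surjective kerAB closed_sum w.
  exists (renorm y + renorm z) => x Sx.
  rewrite linearDr /= -!adjointP.
  apply: le_trans (renormD (inner (A x) y : R[i]^o) (inner (B x) z)) _.
  have := cauchy_schwarz (A x) y; have := cauchy_schwarz (B x) z.
  have := renorm_ge0 (A x); have := renorm_ge0 (B x).
  have := renorm_ge0 y; have := renorm_ge0 z.
  move: Sx; rewrite /S /=; nra.
have M0 : 0 <= M.
  have : S 0 by rewrite /S /= !linear0 !renorm0 addr0.
  by move=> /SM; rewrite renorm0.
exists M => // x.
set q := renorm (A x) + renorm (B x).
have q0 : 0 <= q by rewrite addr_ge0 // renorm_ge0.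
have [q_eq0|qn0] := eqVneq q 0.
  suff -> : x = 0 by rewrite renorm0 mulr_ge0.
  move/eqP: q_eq0; rewrite paddr_eq0 ?renorm_ge0 // !renorm_eq0.
  by move=> /andP[/eqP Ax /eqP Bx]; exact: kerAB.
have qV0 : 0 <= q^-1 by rewrite invr_ge0.
have : S ((q^-1)%:C *: x).
  by rewrite /S /= !linearZ /= !renormZ renorm_real // -mulrDr mulVf.
move=> /SM; rewrite renormZ renorm_real // mulrC ler_pdivrMr //.
by rewrite lt_def qn0.
Qed.

Lemma closed_joint_range : closed [set (A x, B x) | x in [set: H1]].
Proof.
have [M M0 below] := bounded_below.
move=> [y z] cl.
have /choice[u uP] (n : nat) : exists x,
    renorm (y - A x) < n.+1%:R^-1 /\ renorm (z - B x) < n.+1%:R^-1.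
  have q0 : 0 < (n.+1%:R^-1)%:C :> R[i] by rewrite ltcR invr_gt0 ltr0Sn.
  have [_ [[x _ <-] []]] := cl _ (nbhsx_ballx (y, z) _ q0).
  rewrite -!ball_normE /ball_ /= !renormE !ltcR => yx zx.
  by exists x.
pose e (n : nat) : R := M * 4 / n.+1%:R.
have ucauchy n m : (n <= m)%N -> renorm (u m - u n) <= e n.
  move=> nm; have [yn zn] := uP n; have [ym zm] := uP m.
  have qnm : (m.+1%:R^-1 : R) <= n.+1%:R^-1.
    by rewrite lef_pV2 ?posrE ?ltr0Sn // ler_nat.
  apply: le_trans (below _) _; rewrite /e -mulrA ler_wpM2l // !linearB.
  have := renormD (A (u m) - y) (y - A (u n)).
  have := renormD (B (u m) - z) (z - B (u n)).
  rewrite !addrA !subrK (renormB (A (u m)) y) (renormB (B (u m)) z).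
  move: (_^-1) (_^-1) qnm yn zn ym zm => a b.
  lra.
have e_small d : 0 < d -> exists n, e n < d.
  move=> d0; have C0 : 0 < M * 4 + 1 by lra.
  have [n nd] := inv_succ_lt (divr_gt0 d0 C0); exists n.
  move: nd; rewrite ltr_pdivlMr // /e.
  have : 0 < (n.+1%:R : R)^-1 by rewrite invr_gt0 ltr0Sn.
  by move: (_^-1) => a; lra.
have [l lu] := renorm_cauchy ucauchy e_small.
(* Both coordinates of the limit are identified by the same continuity argument. *)
suff E (T : 'B(H1, H2)) v :
    (forall n, renorm (v - T (u n)) < n.+1%:R^-1) -> T l = v.
  by exists l => //; rewrite (E A y) ?(E B z) // => n; case: (uP n).
move=> vT; have [C C0 TC] := bounded_renorm T.
apply/eqP; rewrite -subr_eq0 -renorm_eq0 eq_le renorm_ge0 andbT.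
apply: (@le_add_inv_succ _ _ _ (C * (M * 4) + 1)) => n; rewrite add0r.
have := renormD (T l - T (u n)) (T (u n) - v).
rewrite addrA subrK -linearB (renormB (T (u n)) v).
have := TC (l - u n); have := lu n; have := vT n; rewrite /e.
have : 0 < (n.+1%:R : R)^-1 by rewrite invr_gt0 ltr0Sn.
move: (_^-1) => a; nra.
Qed.
End JointlyBoundedBelow.

(** * Commutant of the quotient and endomorphisms of the representation *)

Section QuotientCommutant.
Context (R : realType) (K : hilbertType R) (A B : 'B(K, K)).
Hypothesis kerA : ker A = [set 0].

Lemma ker_inj x y : A x = A y -> x = y.
Proof.
move=> Axy; apply/eqP; rewrite -subr_eq0; apply/eqP.
have : ker A (x - y) by rewrite /ker /= linearB Axy subrr.
by rewrite kerA.
Qed.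

Lemma quotient_graph :
  [set p : K * K | op_dom (quotient B kerA) p.1 /\ p.2 = quotient B kerA p.1] =
  [set (A x, B x) | x in [set: K]].
Proof.
apply/seteqP; split=> [[y z] /= [[x _ Ax] ->]|_ [x _ <-] /=].
  by exists x; rewrite // -Ax [quotient_fun _ _ _]quotient_funE.
by split; [exists x | rewrite [RHS]quotient_funE].
Qed.

(** The lift is [A^-1 S A]; its boundedness comes from the lower bound on the pair
    [(A, B)], as both [A] and [B] send its values to values of [S]. *)
Lemma commutant_lift (M : R) :
  (forall x, renorm x <= M * (renorm (A x) + renorm (B x))) -> 0 <= M ->
  forall S : 'B(K, K), commutant (quotient B kerA) S ->
  exists S1 : 'B(K, K), rep_End (KroneckerRep A B) (S1, S).
Proof.
move=> below M0 S [Sdom Scomm].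
have /choice[f fE] x : exists y, A y = S (A x).
  by have [|y _ Ay] := Sdom (A x); [exists x | exists y].
have fB x : B (f x) = S (B x).
  have := Scomm (A x) (ex_intro2 _ _ x Logic.I erefl).
  by rewrite /= -fE !(quotient_funE B kerA).
have flin : linear f.
  by move=> a x y; apply: ker_inj; rewrite !linearP !fE -linearP -linearP.
have [C C0 SC] := bounded_renorm S.
have [CA CA0 AC] := bounded_renorm A.
have [CB CB0 BC] := bounded_renorm B.
pose fL : {linear K -> K} := HB.pack f (GRing.isLinear.Build _ _ _ _ f flin).
have fbound : exists M' : R[i], forall x, `|fL x| <= M' * `|x|.
  exists (M * (C * (CA + CB)))%:C => x.
  rewrite !renormE -rmorphM lecR; apply: le_trans (below _) _.
  rewrite -!mulrA ler_wpM2l //= fE fB.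
  have := SC (A x); have := SC (B x); have := AC x; have := BC x.
  nra.
by exists (BoundedOperator fbound); split=> x /=; rewrite ?fE ?fB.
Qed.
End QuotientCommutant.

Theorem proposition3p7 (R : realType) (K : hilbertType R) (A B : 'B(K, K))
    (kerA : ker A = [set 0])
    (ImAB : closed [set x + y | x in range (adjoint A) & y in range (adjoint B)]) :
  transitive_operator (quotient B kerA) <->
  transitive_rep (KroneckerRep A B).
Proof.
have kerAB x : A x = 0 -> B x = 0 -> x = 0.
  by move=> Ax _; apply: (ker_inj kerA); rewrite Ax linear0.
split=> [[_ trans]|trans].
  apply/seteqP; split=> [[S1 S] [/= SA SB]|[S1 S] [c /= [S1c Sc]]]; last first.
    by split=> x /=; rewrite S1c Sc linearZ.
  have [|c Sc] := trans S.
    split=> [_ [x _ <-]|_ [x _ <-]] /=.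
      by exists (S1 x).
    by rewrite -SA !(quotient_funE B kerA) SB.
  exists c; split=> //= x; apply: (ker_inj kerA).
  by rewrite SA Sc linearZ.
have [M M0 below] := bounded_below kerAB ImAB.
split.
  rewrite /closed_operator quotient_graph.
  exact: closed_joint_range kerAB ImAB.
move=> S /(commutant_lift below M0)[S1].
by rewrite trans => -[c [_ Sc]]; exists c.
Qed.
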